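(* Let $p\in\mathbb{R}[\boldsymbol{x}]$ and let $\mathcal{I}\subset\mathbb{R}[\boldsymbol{x}]$ be an ideal. Suppose there exist $\mathcal{I}$-spherical polynomials $h_1,\dots,h_m\in\mathbb{R}[\boldsymbol{x}]$ such that $p+\mathcal{I}\in\mathrm{Alg}_{\mathcal{I}}(h_1,\dots,h_m)$. Then there exist a vector of polynomials $\boldsymbol{z}\in\mathbb{R}[\boldsymbol{x}]^d$ (for some $d$) and real symmetric $d\times d$ matrices $\boldsymbol{M}(1),\boldsymbol{M}(p)$ satisfying $\boldsymbol{M}(1)\succ0$, $1\equiv_{\mathcal{I}}\boldsymbol{z}^T\boldsymbol{M}(1)\boldsymbol{z}$, and $p\equiv_{\mathcal{I}}\boldsymbol{z}^T\boldsymbol{M}(p)\boldsymbol{z}$.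
   Context: $\mathbb{R}[\boldsymbol{x}]$ is the polynomial ring in $\boldsymbol{x}=(x_1,\dots,x_n)$. For an ideal $\mathcal{I}$, $f\equiv_{\mathcal{I}}g$ means $f-g\in\mathcal{I}$. Polynomials $h_1,\dots,h_m$ are $\mathcal{I}$-spherical if $\sum_{i=1}^m h_i^2\equiv_{\mathcal{I}}1$. $\mathrm{Alg}_{\mathcal{I}}(h_1,\dots,h_m)$ is the subalgebra of $\mathbb{R}[\boldsymbol{x}]/\mathcal{I}$ generated by $h_1+\mathcal{I},\dots,h_m+\mathcal{I}$, i.e. all finite $\mathbb{R}$-linear combinations of finite products of these elements. *)

(* Defs.v *)
From HB Require Import structures.
From mathcomp Require Import all_boot all_order all_algebra.
From mathcomp Require Import reals.
From mathcomp Require Import mpoly.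

Set Implicit Arguments.
Unset Strict Implicit.
Unset Printing Implicit Defensive.

Import GRing.Theory.

Local Open Scope ring_scope.
Local Open Scope quotient_scope.

(* Unlike [idealr], this structure allows the improper ideal. Membership is
   boolean, as for [idealr]; this is no restriction over a [realType], whose
   theory assumes classical logic. *)
HB.mixin Record isMulAbsorbing (A : comPzRingType) (I : {pred A}) := {
  absorbing_mull : forall a u : A, u \in I -> a * u \in I
}.

#[short(type="ideal")]
HB.structure Definition Ideal (A : comPzRingType) :=
  {I of GRing.ZmodClosed A I & isMulAbsorbing A I}.

Definition eq_mod (A : comPzRingType) (I : ideal A) (f g : A) : Prop :=
  f - g \in I.

Notation "f '≡_[' I ] g" := (eq_mod I f g)
  (at level 70, I at level 200, g at next level).

(* The library makes [{ideal_quot I}] a ring, and a nontrivial one, only for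
   proper [I]. The alias [quot_alg I] carries the possibly trivial commutative
   ring structure and the module structure; as [lalgType] requires a nontrivial
   ring, their compatibility is only the lemma [quot_scaleAl]. *)
Section QuotientAlgebra.
Variables (K : comPzRingType) (A : comAlgType K) (I : ideal A).

Definition quot_alg : Type := {ideal_quot I}.

HB.instance Definition _ := GRing.Zmodule.on quot_alg.

Definition quot_class (f : A) : quot_alg := \pi_{ideal_quot I} f.

Lemma quot_classP f g : quot_class f = quot_class g <-> f ≡_[I] g.
Proof.
by rewrite /eq_mod Quotient.idealrBE; split=> [/eqP|/eqP].
Qed.

Definition quot_one : quot_alg := quot_class 1.
Definition quot_mul (x y : quot_alg) : quot_alg :=
  quot_class (repr x * repr y).
Definition quot_scale (c : K) (x : quot_alg) : quot_alg :=
  quot_class (c *: repr x).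

Lemma quot_classK x : quot_class (repr x) = x.
Proof. exact: reprK. Qed.

Lemma quot_classD f g : quot_class (f + g) = quot_class f + quot_class g.
Proof. exact: raddfD (\pi_{ideal_quot I}) f g. Qed.

Lemma repr_quot_class f : repr (quot_class f) ≡_[I] f.
Proof. by apply/quot_classP; rewrite quot_classK. Qed.

Lemma quot_mulE f g :
  quot_mul (quot_class f) (quot_class g) = quot_class (f * g).
Proof.
apply/quot_classP; rewrite /eq_mod.
set f' := repr _; set g' := repr _.
have -> : f' * g' - f * g = g' * (f' - f) + f * (g' - g).
  by rewrite !mulrBr addrA [g' * f]mulrC subrK mulrC.
by apply: rpredD; apply: absorbing_mull; apply: repr_quot_class.
Qed.

Lemma quot_scaleE c f : quot_scale c (quot_class f) = quot_class (c *: f).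
Proof.
apply/quot_classP; rewrite /eq_mod -scalerBr -mulr_algl.
by apply: absorbing_mull; apply: repr_quot_class.
Qed.

Lemma quot_mulA : associative quot_mul.
Proof.
move=> x y z; rewrite -(quot_classK x) -(quot_classK y) -(quot_classK z).
by rewrite !quot_mulE mulrA.
Qed.

Lemma quot_mulC : commutative quot_mul.
Proof. by move=> x y; rewrite /quot_mul mulrC. Qed.

Lemma quot_mul1 : left_id quot_one quot_mul.
Proof. by move=> x; rewrite -(quot_classK x) quot_mulE mul1r. Qed.

Lemma quot_mulDl : left_distributive quot_mul +%R.
Proof.
move=> x y z; rewrite -(quot_classK x) -(quot_classK y) -(quot_classK z).
by rewrite -quot_classD !quot_mulE -quot_classD mulrDl.
Qed.

HB.instance Definition _ := GRing.Zmodule_isComPzRing.Build quot_alg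
  quot_mulA quot_mulC quot_mul1 quot_mulDl.

Lemma quot_scaleA a b x :
  quot_scale a (quot_scale b x) = quot_scale (a * b) x.
Proof. by rewrite -(quot_classK x) !quot_scaleE scalerA. Qed.

Lemma quot_scale1 : left_id 1 quot_scale.
Proof. by move=> x; rewrite -(quot_classK x) quot_scaleE scale1r. Qed.

Lemma quot_scaleDr : right_distributive quot_scale +%R.
Proof.
move=> c x y; rewrite -(quot_classK x) -(quot_classK y).
by rewrite -quot_classD !quot_scaleE -quot_classD scalerDr.
Qed.

Lemma quot_scaleDl x : {morph quot_scale^~ x : a b / a + b}.
Proof.
by move=> a b; rewrite -(quot_classK x) !quot_scaleE -quot_classD scalerDl.
Qed.

HB.instance Definition _ := GRing.Zmodule_isLmodule.Build K quot_alg
  quot_scaleA quot_scale1 quot_scaleDr quot_scaleDl.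

Lemma quot_scaleAl (c : K) (x y : quot_alg) : c *: (x * y) = c *: x * y.
Proof.
change (quot_scale c (quot_mul x y) = quot_mul (quot_scale c x) y).
rewrite -(quot_classK x) -(quot_classK y).
by rewrite quot_mulE !quot_scaleE quot_mulE scalerAl.
Qed.

End QuotientAlgebra.

(* Empty products are allowed, so the subalgebra is unital. *)
Definition in_Alg (K : comPzRingType) (A : comAlgType K) (I : ideal A)
    (m : nat) (h : 'I_m -> A) (x : quot_alg I) : Prop :=
  exists s : seq (K * seq 'I_m),
    x = \sum_(t <- s) t.1 *: \prod_(i <- t.2) quot_class I (h i).

Definition spherical (A : comPzRingType) (I : ideal A)
    (m : nat) (h : 'I_m -> A) : Prop :=
  \sum_(i < m) h i ^+ 2 ≡_[I] 1.

Definition posdefmx (R : realType) (d : nat) (M : 'M[R]_d) : Prop :=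
  M \is symmetricmx /\
  forall v : 'cV[R]_d, v != 0 -> 0 < (v^T *m M *m v) 0 0.

Definition gram_form (R : realType) (n d : nat) (M : 'M[R]_d)
    (z : 'cV[{mpoly R[n]}]_d) : {mpoly R[n]} :=
  (z^T *m map_mx (@mpolyC n R) M *m z) 0 0.

(* Main.v *)
(** If [h_1, ..., h_m] are spherical, then for each [k] the squares of the words
    of length [k] in the [h_i] sum to [(h_1^2 + ... + h_m^2)^k = 1] modulo the
    ideal. So let [z] list [1] and, for each monomial in an expression of [p],
    all words of the same length as that monomial. The squares of the entries
    of [z] sum to a positive integer [N], so [M(1)] can be [1/N] times the
    identity. As [p = a^T z] for a real vector [a], and [1] is an entry of [z],
    [p = 1 * (a^T z)] is a quadratic form in [z], and [M(p)] is its
    symmetrisation. *)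
Require Import Defs.
From HB Require Import structures.
From mathcomp Require Import all_boot all_order all_algebra.
From mathcomp Require Import reals.
From mathcomp Require Import mpoly.

Set Implicit Arguments.
Unset Strict Implicit.
Unset Printing Implicit Defensive.

Import Order.TTheory GRing.Theory Num.Theory.

Local Open Scope ring_scope.

Section QuotientMorphism.
Variables (K : comPzRingType) (A : comAlgType K) (I : ideal A).

Lemma quot_class_is_zmod_morphism : zmod_morphism (quot_class I).
Proof. exact: raddfB (\pi_{ideal_quot I}%qT). Qed.

Lemma quot_class_is_monoid_morphism : monoid_morphism (quot_class I).
Proof. by split=> [//|f g]; rewrite -quot_mulE. Qed.

HB.instance Definition _ := GRing.isZmodMorphism.Build A (quot_alg I)
  (quot_class I) quot_class_is_zmod_morphism.
HB.instance Definition _ := GRing.isMonoidMorphism.Build A (quot_alg I)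
  (quot_class I) quot_class_is_monoid_morphism.

Lemma quot_classZ (c : K) f : quot_class I (c *: f) = c *: quot_class I f.
Proof. by rewrite -quot_scaleE. Qed.

End QuotientMorphism.

(* A list of pairs [(a, z)] encodes both the linear combination [\sum a *: z]
   and the vector of its [z]s. *)
Section SphericalWords.
Variables (K : comPzRingType) (A : comAlgType K) (I : ideal A).
Variables (m : nat) (h : 'I_m -> A).
Hypothesis sph_h : spherical I h.

(** By induction on [w], the list runs over all words of the same length, with coefficient 1 at [w]
    itself and 0 at the others. *)
Lemma spherical_word (w : seq 'I_m) : exists l : seq (K * A),
  \sum_(t <- l) t.1 *: t.2 = \prod_(i <- w) h i /\
  \sum_(t <- l) t.2 ^+ 2 ≡_[I] 1.
Proof.
have /quot_classP h_1 := sph_h; elim: w => [|i w [l [l_w /quot_classP l_1]]].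
  exists [:: (1, 1)]; rewrite !big_seq1 big_nil scale1r expr1n.
  by split=> //; apply/quot_classP.
(* Prepending every letter [j] multiplies the sum of squares by that of the [h j], which is 1 modulo
   [I]; the indicator keeps only the letter [i] in the linear combination. *)
exists [seq ((j == i)%:R * t.1, h j * t.2) | j <- index_enum 'I_m, t <- l].
rewrite !big_allpairs_dep /= big_cons -l_w; split.
  rewrite (bigD1 i) //= [X in _ + X]big1 => [|j /negPf->].
    rewrite addr0 mulr_sumr; apply: eq_bigr => t _.
    by rewrite eqxx mul1r scalerAr.
  by rewrite big1 // => t _; rewrite mul0r scale0r.
apply/quot_classP.
rewrite (eq_bigr (fun j => h j ^+ 2 * \sum_(t <- l) t.2 ^+ 2)) => [|j _].
  by rewrite -mulr_suml rmorphM /= l_1 h_1 -rmorphM mulr1.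
by rewrite mulr_sumr; apply: eq_bigr => t _; rewrite exprMn.
Qed.

(** Concatenating the lists of the monomials adds both sums, and each monomial contributes 1 to the
    squares. *)
Lemma spherical_span (s : seq (K * seq 'I_m)) : exists l : seq (K * A),
  \sum_(t <- l) t.1 *: t.2 = \sum_(t <- s) t.1 *: \prod_(i <- t.2) h i /\
  \sum_(t <- l) t.2 ^+ 2 ≡_[I] (size s)%:R.
Proof.
elim: s => [|[c w] s [l [l_s /quot_classP l_N]]].
  by exists [::]; rewrite !big_nil; split=> //; apply/quot_classP.
have [k [k_w /quot_classP k_1]] := spherical_word w.
(* The scalar [c] goes into the coefficients only, so the squares are unaffected. *)
exists ([seq (c * t.1, t.2) | t <- k] ++ l).
rewrite !big_cat !big_map big_cons /= l_s -k_w scaler_sumr; split.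
  by congr (_ + _); apply: eq_bigr => t _; rewrite scalerA.
apply/quot_classP.
by rewrite rmorphD /= k_1 l_N -rmorphD nat1r.
Qed.

End SphericalWords.

Section GramForm.
Variables (R : realType) (n d : nat) (z : 'cV[{mpoly R[n]}]_d).

Lemma gram_formE (M : 'M[R]_d) :
  gram_form M z = \sum_i \sum_j M i j *: (z i 0 * z j 0).
Proof.
rewrite /gram_form mxE exchange_big; apply: eq_bigr => j _.
rewrite mxE mulr_suml; apply: eq_bigr => i _.
by rewrite !mxE -mul_mpolyC mulrAC mulrC.
Qed.

Lemma gram_form_scalar c :
  gram_form c%:M z = c *: \sum_i z i 0 ^+ 2.
Proof.
rewrite gram_formE scaler_sumr; apply: eq_bigr => i _.
rewrite (bigD1 i) //= big1 ?addr0 => [|j]; first by rewrite mxE eqxx expr2.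
by rewrite mxE eq_sym => /negPf->; rewrite scale0r.
Qed.

Lemma gram_form_tr (M : 'M[R]_d) : gram_form M^T z = gram_form M z.
Proof.
rewrite !gram_formE exchange_big; apply: eq_bigr => i _.
by apply: eq_bigr => j _; rewrite mxE mulrC.
Qed.

Lemma gram_formD (M N : 'M[R]_d) :
  gram_form (M + N) z = gram_form M z + gram_form N z.
Proof. by rewrite /gram_form map_mxD mulmxDr mulmxDl mxE. Qed.

Lemma symmetric_gram_form (M : 'M[R]_d) :
  exists2 S : 'M[R]_d, S \is symmetricmx & gram_form S z = gram_form M z.
Proof.
(* A matrix and its transpose have the same form, so the two halves add up to that of [M]. *)
pose H := 2^-1 *: M; exists (H + H^T).
  apply/is_hermitianmxP.
  by rewrite expr0 scale1r map_mx_id // linearD /= trmxK addrC.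
rewrite gram_formD gram_form_tr -gram_formD -scalerDl.
by rewrite -{1 2}[2^-1]mul1r -splitr scale1r.
Qed.

End GramForm.

Lemma posdefmx_scalar (R : realType) (d : nat) (c : R) :
  0 < c -> posdefmx (c%:M : 'M[R]_d).
Proof.
move=> c_gt0; split.
  by apply/is_hermitianmxP; rewrite expr0 scale1r map_mx_id // tr_scalar_mx.
move=> v /cV0Pn[i vi_neq0].
rewrite mul_mx_scalar -scalemxAl mxE mulr_gt0 // mxE (bigD1 i) //= mxE -expr2.
rewrite ltr_pwDl ?exprn_even_gt0 // sumr_ge0 // => j _.
by rewrite mxE -expr2 sqr_ge0.
Qed.

Theorem lemma3p1 (R : realType) (n : nat) (p : {mpoly R[n]})
    (I : ideal {mpoly R[n]}) :
  (exists (m : nat) (h : 'I_m -> {mpoly R[n]}),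
      spherical I h /\ in_Alg h (quot_class I p)) ->
  exists (d : nat) (z : 'cV[{mpoly R[n]}]_d) (M1 Mp : 'M[R]_d),
    [/\ M1 \is symmetricmx, Mp \is symmetricmx, posdefmx M1,
        1 ≡_[I] gram_form M1 z & p ≡_[I] gram_form Mp z].
Proof.
move=> [m [h [sph_h [s p_s]]]].
have [l [l_s /quot_classP l_N]] := spherical_span sph_h s.
(* The extra pair [(0, 1)] makes 1 the first entry of [z] without changing the linear
   combination. *)
pose d := size l; pose x := nth (0, 1) ((0, 1) :: l).
pose z : 'cV[{mpoly R[n]}]_d.+1 := \col_i (x i).2.
(* The squares sum to [size s] over [l], plus 1 for the extra entry. *)
pose c : R := (size s).+1%:R^-1.
have c_gt0 : 0 < c by rewrite invr_gt0 ltr0n.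
have sum_x (F : R * {mpoly R[n]} -> {mpoly R[n]}) :
    \sum_(i < d.+1) F (x i) = F (0, 1) + \sum_(t <- l) F t.
  by rewrite big_ord_recl (big_nth (0, 1)) big_mkord.
(* With the coefficients in row 0 and zeros elsewhere, the form is [z 0 0 = 1] times the linear
   combination. *)
have [S symS S_z] := symmetric_gram_form z
  (\matrix_(i, j) (if i == 0 then (x j).1 else 0)).
have [sym1 pos1] := posdefmx_scalar d.+1 c_gt0.
exists d.+1, z, c%:M, S; split=> //.
  apply/quot_classP; rewrite gram_form_scalar quot_classZ.
  under eq_bigr do rewrite mxE.
  rewrite (sum_x (fun t => t.2 ^+ 2)) expr1n rmorphD /= l_N.
  rewrite -rmorphD /= -quot_classZ nat1r -scaler_nat scalerA mulVf ?scale1r //.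
  by rewrite pnatr_eq0.
apply/quot_classP; rewrite S_z gram_formE.
rewrite (bigD1 0) //= [X in _ + X]big1 => [|i].
  under eq_bigr do rewrite !mxE eqxx mul1r.
  rewrite addr0 (sum_x (fun t => t.1 *: t.2)) scale0r add0r l_s p_s raddf_sum.
  by apply: eq_bigr => t _; rewrite /= quot_classZ rmorph_prod.
by move=> /negPf i0; rewrite big1 // => j _; rewrite mxE i0 scale0r.
Qed.
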